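(* Let $X$ be a real Banach space and $Y$ a closed linear subspace of $X$ with $Y\in(GC)$. Then $Y$ is a restricted central subspace of $X$ if and only if $Y$ is a central subspace of $X$.
   Context: $B_X(a,r)$ and $B_Y(a,r)$ denote closed balls in $X$ and $Y$. A Banach space $Z$ belongs to the class $(GC)$ if for every $n\in\mathbb{N}$, $a_1,\dots,a_n\in Z$ and $r_1,\dots,r_n>0$, $\bigcap_{i=1}^nB_{Z^{**}}(a_i,r_i)\ne\emptyset$ implies $\bigcap_{i=1}^nB_Z(a_i,r_i)\neq\emptyset$ ($Z$ canonically embedded in $Z^{**}$). $Y$ is a central subspace of $X$ if for every finite family $a_1,\dots,a_n\in Y$, $r_1,\dots,r_n>0$ with $\bigcap_{i=1}^nB_X(a_i,r_i)\ne\emptyset$ one has $\bigcap_{i=1}^nB_Y(a_i,r_i)\ne\emptyset$. $Y$ is a restricted central subspace of $X$ if for every finite family $a_1,\dots,a_n\in Y$ and every single radius $r>0$ with $\bigcap_{i=1}^nB_X(a_i,r)\ne\emptyset$ one has $\bigcap_{i=1}^nB_Y(a_i,r)\ne\emptyset$. *)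

(* Defs.v *)
From HB Require Import structures.
From mathcomp Require Import all_boot all_order all_algebra.
From mathcomp Require Import boolp classical_sets functions reals topology normedtype.
Set Implicit Arguments.
Unset Strict Implicit.
Unset Printing Implicit Defensive.
Import Order.TTheory GRing.Theory Num.Theory.
Import numFieldNormedType.Exports.
Local Open Scope classical_set_scope.
Local Open Scope ring_scope.

Section Dual.
Context (R : realType) (Z : normedModType R).

Definition clinear : {pred Z -> R^o} :=
  [pred f : Z -> R^o | `[< linear f /\ continuous f >]].

Lemma clinearP (f : Z -> R^o) :
  reflect (linear f /\ continuous f) (f \in clinear).
Proof. exact: asboolP. Qed.

Lemma clinear_submod_closed : submod_closed clinear.
Proof.
split=> [|a f g /clinearP[lf cf] /clinearP[lg cg]]; apply/clinearP.
  split=> [b x y|]; first by rewrite /= /GRing.zero/= scaler0 addr0.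
  exact: cst_continuous.
split=> [b x y|x].
  have E h : (a *: f + g) h = a *: f h + g h by [].
  rewrite !E lf lg !scalerDr !scalerA [a * b]mulrC.
  by rewrite addrACA.
by apply: cvgD; [apply: cvgZl_tmp; exact: cf|exact: cg].
Qed.

HB.instance Definition _ :=
  GRing.isSubmodClosed.Build R (Z -> R^o) clinear clinear_submod_closed.

Record dual := Dual { dual_fun :> Z -> R^o; dual_funP : dual_fun \in clinear }.

HB.instance Definition _ := [isSub for dual_fun].
HB.instance Definition _ := [Choice of dual by <:].
HB.instance Definition _ := [SubChoice_isSubLmodule of dual by <:].

Definition dual_norm (f : dual) : R :=
  sup [set `|f x| | x in [set x : Z | `|x| <= 1]].

Lemma dual_linear (f : dual) : linear f.
Proof. by have /clinearP[] := dual_funP f. Qed.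

Lemma dual_fun0 (f : dual) : f 0 = 0.
Proof.
by have := dual_linear f (-1) 0 0; rewrite scaler0 addr0 scaleN1r addNr.
Qed.

Lemma dual_has_sup (f : dual) :
  has_sup [set `|f x| | x in [set x : Z | `|x| <= 1]].
Proof.
split; first by exists `|f 0|; exists 0 => //=; rewrite normr0.
have /clinearP[lf cf] := dual_funP f.
pose g : {linear Z -> R^o} := HB.pack (f : Z -> R^o)
  (GRing.isLinear.Build _ _ _ _ _ lf).
have /linear_bounded_continuous/bounded_funP/(_ 1)[M MP] : continuous g by [].
by exists M => _ [x /= x1 <-]; exact: MP.
Qed.

Lemma dual_norm_ub (f : dual) (x : Z) : `|x| <= 1 -> `|f x| <= dual_norm f.
Proof.
move=> x1; apply: ub_le_sup; first by have [] := dual_has_sup f.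
by exists x.
Qed.

Lemma dual_norm_le (f : dual) (M : R) :
  (forall x, `|x| <= 1 -> `|f x| <= M) -> dual_norm f <= M.
Proof.
move=> fM; apply: ge_sup; first by have [] := dual_has_sup f.
by move=> _ [x /= x1 <-]; exact: fM.
Qed.

Lemma dual_normD (f g : dual) : dual_norm (f + g) <= dual_norm f + dual_norm g.
Proof.
apply: dual_norm_le => x x1; apply: (le_trans (ler_normD (f x) (g x))).
by apply: lerD; exact: dual_norm_ub.
Qed.

Lemma dual_norm_ge0 (f : dual) : 0 <= dual_norm f.
Proof.
by apply: le_trans (dual_norm_ub f (x := 0) _); rewrite ?normr_ge0 ?normr0.
Qed.

Lemma dual_normZ (a : R) (f : dual) : dual_norm (a *: f) = `|a| * dual_norm f.
Proof.
have E x : (a *: f) x = a * f x by [].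
apply/eqP; rewrite eq_le; apply/andP; split.
  apply: dual_norm_le => x x1; rewrite E normrM ler_wpM2l//.
  exact: dual_norm_ub.
have [->|a0] := eqVneq a 0; first by rewrite normr0 mul0r dual_norm_ge0.
rewrite -ler_pdivlMl ?normr_gt0//; apply: dual_norm_le => x x1.
by rewrite ler_pdivlMl ?normr_gt0// -normrM -E dual_norm_ub.
Qed.

Lemma dual_norm_bound (f : dual) (x : Z) : `|f x| <= dual_norm f * `|x|.
Proof.
have [->|x0] := eqVneq x 0; first by rewrite dual_fun0 !normr0 mulr0.
have := dual_norm_ub f (x := `|x|^-1 *: x); rewrite normfZV// => /(_ (lexx _)).
have := dual_linear f `|x|^-1 x 0; rewrite !addr0 dual_fun0 addr0 => ->.
by rewrite normrZ normfV normr_id mulrC ler_pdivrMr ?normr_gt0.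
Qed.

Lemma dual_norm0_eq0 (f : dual) : dual_norm f = 0 -> f = 0.
Proof.
move=> f0; apply: val_inj; apply/funext => x /=; apply/eqP.
by rewrite -normr_le0 (le_trans (dual_norm_bound f x))// f0 mul0r.
Qed.

HB.instance Definition _ :=
  Lmodule_isNormed.Build R dual dual_normD dual_normZ dual_norm0_eq0.

End Dual.
Arguments clinear {R} Z : rename.

Section Bidual.
Context (R : realType) (Z : normedModType R).

Lemma eval_clinear (z : Z) : (fun f : dual Z => f z : R^o) \in clinear (dual Z).
Proof.
have le : linear (fun f : dual Z => f z : R^o) by [].
apply/clinearP; split=> //.
pose g : {linear dual Z -> R^o} := HB.pack (fun f : dual Z => f z : R^o)
  (GRing.isLinear.Build _ _ _ _ _ le).
suff : continuous g by [].
apply/linear_bounded_continuous/bounded_funP => r; exists (r * `|z|) => f fr /=.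
by rewrite (le_trans (dual_norm_bound f z))// ler_wpM2r.
Qed.

Definition bidual_embed (z : Z) : dual (dual Z) := Dual (eval_clinear z).

End Bidual.

Section Subspace.
Context (R : realType) (X : normedModType R) (Y : submodClosed X).

Record subspace_of := SubspaceOf
  { subspace_val : X; subspace_valP : subspace_val \in Y }.

HB.instance Definition _ := [isSub for subspace_val].
HB.instance Definition _ := [Choice of subspace_of by <:].
HB.instance Definition _ := [SubChoice_isSubLmodule of subspace_of by <:].

Definition subspace_norm (y : subspace_of) : R := `|subspace_val y|.

Lemma subspace_normD (x y : subspace_of) :
  subspace_norm (x + y) <= subspace_norm x + subspace_norm y.
Proof. exact: ler_normD. Qed.

Lemma subspace_normZ (a : R) (x : subspace_of) :
  subspace_norm (a *: x) = `|a| * subspace_norm x.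
Proof. exact: normrZ. Qed.

Lemma subspace_norm0_eq0 (x : subspace_of) : subspace_norm x = 0 -> x = 0.
Proof. by move=> /normr0_eq0 x0; exact: val_inj. Qed.

HB.instance Definition _ := Lmodule_isNormed.Build R subspace_of
  subspace_normD subspace_normZ subspace_norm0_eq0.

Lemma subspace_of_norm (y : subspace_of) : `|y| = `|subspace_val y|.
Proof. by []. Qed.

End Subspace.

Lemma subspace_of_complete (R : realType) (X : completeNormedModType R)
    (Y : submodClosed X) (F : set_system (subspace_of Y)) :
  closed [set` Y] -> ProperFilter F -> cauchy F -> cvg F.
Proof.
move=> Ycl FF Fc; set v := @subspace_val R X Y.
have Gc : cauchy (v @ F).
  apply: (@cauchy_exP R) => e e0; have [x xF] := (@cauchyP R _ F FF).1 Fc e e0.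
  exists (v x); apply: (@filterS _ F _ (ball x e) _ _ xF) => y.
  by rewrite -ball_normE => xy; rewrite /= -ball_normE.
have /cvg_ex[l Fl] : cvg (v @ F) by exact: cauchy_cvg.
have Yl : [set` Y] l.
  apply: (@closed_cvg _ _ F _ v [set` Y] Ycl _ l Fl).
  by apply: filterE => y; exact: subspace_valP.
apply/cvg_ex; exists (SubspaceOf Yl); apply/cvgrPdist_lt => e e0.
by move/cvgrPdist_lt: Fl => /(_ e e0).
Qed.

(* The library's [closed_ball a r] is the closure of the open ball; for r > 0
   it equals [set y | `|a - y| <= r] in any normed module ([closed_ballE]).
   The families below are indexed by 'I_n with n = 0 allowed; both sides of
   each implication then hold trivially. *)

(* Meant for complete [Z]; a closed subspace of a Banach space is complete by
   [subspace_of_complete]. *)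
Definition GC (R : realType) (Z : normedModType R) : Prop :=
  forall (n : nat) (a : 'I_n -> Z) (r : 'I_n -> R), (forall i, 0 < r i) ->
    \bigcap_i closed_ball (bidual_embed (a i)) (r i) !=set0 ->
    \bigcap_i closed_ball (a i) (r i) !=set0.

Definition central_subspace (R : realType) (X : normedModType R)
    (Y : submodClosed X) : Prop :=
  forall (n : nat) (a : 'I_n -> subspace_of Y) (r : 'I_n -> R),
    (forall i, 0 < r i) ->
    \bigcap_i closed_ball (subspace_val (a i)) (r i) !=set0 ->
    \bigcap_i closed_ball (a i) (r i) !=set0.

Definition restricted_central_subspace (R : realType) (X : normedModType R)
    (Y : submodClosed X) : Prop :=
  forall (n : nat) (a : 'I_n -> subspace_of Y) (r : R), 0 < r ->
    \bigcap_i closed_ball (subspace_val (a i)) r !=set0 ->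
    \bigcap_i closed_ball (a i) r !=set0.

(* Main.v *)
Require Import Defs.
From mathcomp Require Import all_boot all_order all_algebra.
From mathcomp Require Import boolp classical_sets functions reals topology normedtype.
From HB Require Import structures.
From mathcomp Require Import finmap.
Set Implicit Arguments.
Unset Strict Implicit.
Unset Printing Implicit Defensive.
Import Order.TTheory GRing.Theory Num.Theory.
Import numFieldNormedType.Exports.
Local Open Scope classical_set_scope.
Local Open Scope ring_scope.

(** A central subspace is restricted central by taking all radii equal. For the
    converse, balls of different radii are traded for many balls of one radius.
    Let [x] lie in the balls of [X] with centers [a_i] in [Y] and radii [r_i],
    and let [rho >= r_i] for all [i]. Then [x] is at distance at most [rho] from
    every point [a_i + z] with [z] in [Y] and [`|z| <= rho - r_i]. Restricted
    centrality gives, for each finite set of such points, an element of [Y]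
    within [rho] of all of them ([restricted_central_finI]).

    There are infinitely many points, so a common solution is sought in the
    bidual, where bounded ultrafilters have weak-star limits
    ([bidual_common_point]): some [phi] in the bidual of [Y] satisfies
    [`|a_i + z - phi| <= rho] for all [i] and [z] as above. If [Y] is nonzero,
    the supremum of [`|z + psi|] over the [z] in [Y] with [`|z| <= s] is
    [s + `|psi|] for every [psi] in the bidual, so [s = rho - r_i] and
    [psi = a_i - phi] give [`|a_i - phi| <= r_i] ([bidual_norm_le_enlarged]). The balls of radii [r_i] thus
    meet in the bidual, and the property (GC) brings them to meet in [Y]. *)

Lemma bidual_embedD (R : realType) (Z : normedModType R) (x y : Z) :
  bidual_embed (x + y) = bidual_embed x + bidual_embed y.
Proof.
apply: val_inj; apply/funext => f /=.
by have := dual_linear f 1 x y; rewrite !scale1r.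
Qed.

(** The absolute value in the dual norm costs nothing, the ball of radius [s]
    being symmetric. *)
Lemma scaled_dual_norm_le (R : realType) (Z : normedModType R) (f : dual Z)
    (s c : R) : 0 <= s ->
  (forall z, `|z| <= s -> f z <= c) -> s * `|f| <= c.
Proof.
have fZ a x : f (a *: x) = a * f x.
  by have := dual_linear f a x 0; rewrite !addr0 dual_fun0 addr0.
rewrite le_eqVlt => /predU1P[<- fc|s0 fc].
  by rewrite mul0r; have := fc 0; rewrite dual_fun0 normr0; apply.
rewrite -ler_pdivlMl//; apply: dual_norm_le => x x1.
rewrite ler_pdivlMl//.
have sx (b : R) : `|b| = s -> `|b *: x| <= s.
  by move=> bs; rewrite normrZ bs ler_piMr// ltW.
have [_|_] := ger0P (f x).
  by rewrite -fZ; apply/fc/sx; exact: gtr0_norm.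
by rewrite mulrN -mulNr -fZ; apply/fc/sx; rewrite normrN; exact: gtr0_norm.
Qed.

(** Test [z + psi] against a functional [f]: its value [f z + psi f] is at most
    [(s + r) * `|f|], while [f z] alone comes arbitrarily close to [s * `|f|]
    on the ball of radius [s]. Hence [psi f <= r * `|f|]. Only vectors [z] of
    the space itself are needed, because the norm of [f] is computed on them. *)
Lemma bidual_norm_le_enlarged (R : realType) (Z : normedModType R)
    (psi : dual (dual Z)) (s r : R) : 0 <= s -> 0 <= r ->
  (forall z, `|z| <= s -> `|bidual_embed z + psi| <= s + r) -> `|psi| <= r.
Proof.
move=> s0 r0 psir.
have psi_le f : psi f <= r * `|f|.
  have : s * `|f| <= (s + r) * `|f| - psi f.
    apply: scaled_dual_norm_le => // z zs; rewrite lerBrDr.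
    apply: le_trans (ler_norm _) _.
    apply: le_trans (dual_norm_bound (bidual_embed z + psi) f) _.
    by rewrite ler_wpM2r// psir.
  by rewrite mulrDl -addrA lerDl subr_ge0.
apply: dual_norm_le => f f1.
have psiN : psi (- f) = - psi f.
  by have := dual_linear psi (-1) f 0; rewrite !addr0 dual_fun0 addr0 !scaleN1r.
apply: le_trans (_ : r * `|f| <= r); last by rewrite ler_piMr.
rewrite ler_norml psi_le andbT lerNl -psiN.
by rewrite -[in leRHS](normrN f) psi_le.
Qed.

(** The image of [U] lies in a compact segment, so it has a cluster point, and
    an ultrafilter converges to its cluster points. *)
Lemma ultra_bounded_cvg (R : realType) (Z : normedModType R) (U : set_system Z)
    (UU : UltraFilter U) (C : R) (f : dual Z) :
  U [set y | `|y| <= C] -> exists l : R, f y @[y --> U] --> l.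
Proof.
move=> UC.
have fUC : ((f : Z -> R) @ U) `[- (dual_norm f * C), dual_norm f * C]%classic.
  apply: (@filterS _ U _ _ _ _ UC) => y /= yC; rewrite in_itv/= -ler_norml.
  by rewrite (le_trans (dual_norm_bound f y))// ler_wpM2l// dual_norm_ge0.
have [l [_ fUl]] := segment_compact _ fUC.
exists l => A lA; have [//|UnA] := in_ultra_setVsetC (f @^-1` A) UU.
by have [x []] := fUl (~` A) A UnA lA.
Qed.

Lemma cvg_norm_le (R : realType) (T : Type) (U : set_system T)
    (UU : ProperFilter U) (g : T -> R) (l c : R) :
  g y @[y --> U] --> l -> (\forall y \near U, `|g y| <= c) -> `|l| <= c.
Proof.
move=> gl gc; have gl' : `|g y| @[y --> U] --> `|l| by exact: cvg_norm.
rewrite -(cvg_lim (@norm_hausdorff _ _) gl'); apply: limr_le => //.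
by apply/cvg_ex; exists `|l|.
Qed.

(** The form of weak-star compactness of bounded sets used here: the limits
    along [U] are taken functional by functional, and linearity and boundedness
    pass to the limit. *)
Lemma ultra_bounded_bidual_limit (R : realType) (Z : normedModType R)
    (U : set_system Z) (UU : UltraFilter U) (C : R) :
  U [set y | `|y| <= C] ->
  exists phi : dual (dual Z), forall f : dual Z, f y @[y --> U] --> phi f.
Proof.
move=> UC.
have [phi phiP] := choice (fun f => ultra_bounded_cvg UU f UC).
have phi_lin : linear (phi : dual Z -> R^o).
  move=> a f g; apply: (@cvg_unique _ (@norm_hausdorff _ _) _ _ _ _ (phiP _)).
  by apply: cvgD (phiP g); apply: cvgZl_tmp; exact: phiP.
pose h : {linear dual Z -> R^o} := HB.pack (phi : dual Z -> R^o)
  (GRing.isLinear.Build _ _ _ _ _ phi_lin).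
have phi_cont : continuous h.
  apply/linear_bounded_continuous/bounded_funP => r; exists (r * C) => f fr.
  apply: (cvg_norm_le _ (phiP f)); apply: filterS UC => y /= yC.
  rewrite (le_trans (dual_norm_bound f y))//.
  by apply: ler_pM => //; exact: dual_norm_ge0.
by exists (Dual (introT (clinearP _) (conj phi_lin phi_cont))).
Qed.

(** Balls centered in the space are weak-star closed in the bidual. *)
Lemma bidual_limit_ball (R : realType) (Z : normedModType R)
    (U : set_system Z) (UU : UltraFilter U) (phi : dual (dual Z))
    (a : Z) (r : R) :
  (forall f : dual Z, f y @[y --> U] --> phi f) ->
  U [set y | `|a - y| <= r] -> `|bidual_embed a - phi| <= r.
Proof.
move=> phiP Ur; apply: dual_norm_le => f f1.
have fay : f a - f y @[y --> U] --> f a - phi f.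
  by apply: cvgB (phiP f); exact: cvg_cst.
apply: (cvg_norm_le _ fay); apply: filterS Ur => y /= ayr.
have -> : f a - f y = f (a - y).
  have := dual_linear f (-1) y a; rewrite !scaleN1r [- y + a]addrC => fE.
  by rewrite [RHS]fE; exact: addrC.
rewrite (le_trans (dual_norm_bound f (a - y)))//.
by apply: le_trans ayr; rewrite ler_piMl.
Qed.

(** By the finite intersection property some ultrafilter contains every one of
    the balls; its weak-star limit belongs to all of them. The index [i0] is
    there to make the ultrafilter bounded. *)
Lemma bidual_common_point (R : realType) (Z : normedModType R) (I : choiceType)
    (D : set I) (i0 : I) (c : I -> Z) (rho : R) : D i0 ->
  finI D (fun i => [set y | `|c i - y| <= rho]) ->
  exists phi : dual (dual Z),
    forall i, D i -> `|bidual_embed (c i) - phi| <= rho.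
Proof.
move=> Di0 /finI_filter /ultraFilterLemma[U [UU FU]].
have Uc i : D i -> U [set y | `|c i - y| <= rho].
  by move=> Di; apply: FU; eexists; [exact: finI_from1 Di|].
have Ubnd : U [set y | `|y| <= `|c i0| + rho].
  apply: filterS (Uc _ Di0) => y /= yrho.
  rewrite -[y](subKr (c i0)); apply: le_trans (ler_normB _ _) _.
  by rewrite lerD2l.
have [phi phiP] := ultra_bounded_bidual_limit UU Ubnd.
by exists phi => i Di; apply: (bidual_limit_ball UU) => //; exact: Uc.
Qed.

(** Restricted centrality is stated for families indexed by ['I_n]; this is the
    same property in the indexing by finite subsets of an arbitrary choice type
    that the finite intersection property uses. *)
Lemma restricted_central_finI (R : realType) (X : normedModType R)
    (Y : submodClosed X) (I : choiceType) (D : set I)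
    (c : I -> subspace_of Y) (rho : R) (x : X) :
  restricted_central_subspace Y -> 0 < rho ->
  (forall i, D i -> `|subspace_val (c i) - x| <= rho) ->
  finI D (fun i => [set y | `|c i - y| <= rho]).
Proof.
move=> rcY rho0 xc S SD; pose s : seq I := S.
have [|y yB] := rcY _ (fun k : 'I_(size s) => c (tnth (in_tuple s) k)) rho rho0.
  exists x => k _; rewrite closed_ballE//=; apply: xc.
  have /SD /set_mem// : tnth (in_tuple s) k \in S by exact: mem_tnth.
exists y => i /= iS; have /tnthP[k ->] : i \in in_tuple s by [].
by have := yB k Logic.I; rewrite closed_ballE.
Qed.

Theorem theorem2p7 (R : realType) (X : completeNormedModType R)
    (Y : submodClosed X) (closedY : closed [set` Y])
    (GCY : GC (subspace_of Y)) :
  restricted_central_subspace Y <-> central_subspace Y.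
Proof.
split=> [rcY|cY]; last by move=> n a r r0; exact: cY.
move=> [|n] a r r0; first by move=> _; exists 0 => -[].
case=> x xB; apply: GCY => //.
(* Any common upper bound of the radii would serve as [rho]. *)
pose rho := \sum_i r i.
have r_le_rho i : r i <= rho.
  by rewrite /rho (bigD1 i)//= lerDl sumr_ge0// => j _; exact: ltW.
have rho0 : 0 < rho by exact: lt_le_trans (r0 ord0) _.
pose D := [set p : 'I_n.+1 * subspace_of Y | `|p.2| <= rho - r p.1].
have D0 : D (ord0, 0) by rewrite /D/= normr0 subr_ge0.
have [|phi phiP] := @bidual_common_point _ _ _ D _ (fun p => a p.1 + p.2) rho D0.
  apply: (restricted_central_finI (x := x)) => // p pD.
  have := xB p.1 I; rewrite closed_ballE//= => xp.
  change (`|subspace_val (a p.1) + subspace_val p.2 - x| <= rho).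
  rewrite addrAC -(subrKC (r p.1) rho); apply: le_trans (ler_normD _ _) _.
  exact: lerD.
exists phi => i _; rewrite closed_ballE//=.
apply: (@bidual_norm_le_enlarged _ _ _ (rho - r i)).
- by rewrite subr_ge0.
- exact: ltW.
move=> z zr; rewrite addrA -bidual_embedD [z + _]addrC subrK.
exact: (phiP (i, z)).
Qed.
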